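(* Assume that the scalar field is $\mathbb C$, and let $\mathcal F$ be a combinatorial family. (a) Every isometry of $X_{\mathcal F}$ is an $\mathcal F$-compatible signed permutation of $(e_i)$. (b) If $\mathcal F$ is compact, then every isometry of $X_{\mathcal F}^*$ is an $\mathcal F$-compatible signed permutation of $(e_i^* )$.
   Context: $\mathbb N=\{1,2,\dots\}$. ''Isometry'' means linear surjective isometry. A sign is a scalar of modulus $1$. $c_{00}$ is the space of finitely supported scalar sequences, with canonical basis $(e_i)_{i\in\mathbb N}$. A combinatorial family is a family $\mathcal F$ of finite subsets of $\mathbb N$ that contains all singletons and is hereditary for inclusion. It is compact if it is closed in $\{0,1\}^{\mathbb N}$ (sets identified with their characteristic functions). $X_{\mathcal F}$ is the completion of $c_{00}$ for the norm $\|x\|_{\mathcal F}=\sup\{\sum_{i\in F}|x(i)|;\ F\in\mathcal F\}$; $(e_i)$ is a $1$-unconditional Schauder basis of $X_{\mathcal F}$, with coordinate functionals $(e_i^* )$, and when $\mathcal F$ is compact $(e_i^* )$ is a Schauder basis of $X_{\mathcal F}^*$. An $\mathcal F$-compatible signed permutation of $(e_i)$ (resp. $(e_i^* )$) is an operator $J$ with $Je_i=\omega_ie_{\pi(i)}$ (resp. $Je_i^*=\omega_ie_{\pi(i)}^*$) for all $i\in\mathbb N$, for some signs $(\omega_i)$ and some permutation $\pi$ of $\mathbb N$ with $\pi(\mathcal F):=\{\pi(F);F\in\mathcal F\}=\mathcal F$. *)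

(* Defs.v *)
From HB Require Import structures.
From mathcomp Require Import all_boot all_order all_algebra finmap.
From mathcomp Require Import complex.
From mathcomp Require Import all_classical all_reals all_analysis.

Set Implicit Arguments.
Unset Strict Implicit.
Unset Printing Implicit Defensive.

Import Order.TTheory GRing.Theory Num.Theory.
Import Normc.

Local Open Scope classical_set_scope.
Local Open Scope ring_scope.
Local Open Scope complex_scope.

(** Index set: {1, 2, ...} is relabelled as {0, 1, ...}, the elements of nat. *)

Definition combinatorial_family (F : set {fset nat}) : Prop :=
  (forall i : nat, F [fset i]%fset) /\
  (forall A B : {fset nat}, (A `<=` B)%fset -> F B -> F A).

(** Closedness in {0, 1}^nat of the set of characteristic functions. *)
Definition compact_family (F : set {fset nat}) : Prop :=
  closed ([set (fun i : nat => i \in A) | A in F] : set cantor_space).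

Section c00.
Variable K : numFieldType.

Definition finsupp_seq : {pred (nat -> K^o)} :=
  mem [set x : nat -> K^o | finite_set [set i | x i != 0]].

Lemma finsupp_seq_submod : submod_closed finsupp_seq.
Proof.
split; first by rewrite inE /= (_ : [set i | _] = set0) // -subset0 => i /=; rewrite eqxx.
move=> a x y; rewrite !inE /= => fx fy.
have fU : finite_set ([set i | x i != 0] `|` [set i | y i != 0]).
  by rewrite finite_setU.
apply: sub_finite_set fU => i /=.
have [x0|] := eqVneq (x i) 0; last by left.
have [y0|] := eqVneq (y i) 0; last by right.
by rewrite /GRing.add /= /GRing.scale /= /GRing.scale /= x0 y0 mulr0 addr0 eqxx.
Qed.

HB.instance Definition _ :=
  GRing.isSubmodClosed.Build K (nat -> K^o) finsupp_seq finsupp_seq_submod.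

Record c00 := C00 { c00_val :> nat -> K^o; _ : c00_val \in finsupp_seq }.

HB.instance Definition _ := [isSub of c00 for c00_val].
HB.instance Definition _ := [Choice of c00 by <:].
HB.instance Definition _ := [SubChoice_isSubLmodule of c00 by <:].

Lemma c00_basis_subproof (i : nat) :
  (fun k : nat => (k == i)%:R : K^o) \in finsupp_seq.
Proof.
rewrite inE /=; apply: sub_finite_set (finite_set1 i) => k /=.
by case: (eqVneq k i) => //= _; rewrite eqxx.
Qed.

Definition c00_basis (i : nat) : c00 := C00 (c00_basis_subproof i).

End c00.

Section dual.
(** Topological dual of a complex normed space, with the operator norm. *)
Variable R : realType.
Local Notation C := (R[i]).
Variable X : normedModType C.

Definition continuous_functional : {pred (X -> C^o)} :=
  mem [set f : X -> C^o | linear f /\ continuous f].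

Lemma continuous_functional_submod : submod_closed continuous_functional.
Proof.
split.
  rewrite inE /=; split; last exact: cst_continuous.
  by move=> a x y; rewrite /= scaler0 addr0.
move=> a f g /set_mem[lf cf] /set_mem[lg cg]; apply/mem_set; split.
  move=> b x y; rewrite !fctE lf lg.
  by rewrite !scalerDr addrACA !scalerA (mulrC a b).
move=> x; apply: (@continuousD _ _ _ (a \*: f) g x); last exact: cg.
by apply: continuousZr; exact: cf.
Qed.

HB.instance Definition _ :=
  GRing.isSubmodClosed.Build C (X -> C^o) continuous_functional
    continuous_functional_submod.

Record cdual := CDual
  { cdual_val :> X -> C^o; _ : cdual_val \in continuous_functional }.

HB.instance Definition _ := [isSub of cdual for cdual_val].
HB.instance Definition _ := [Choice of cdual by <:].
HB.instance Definition _ := [SubChoice_isSubLmodule of cdual by <:].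

Definition dual_norm (f : cdual) : R :=
  sup [set normc (f x) | x in [set x : X | `|x| <= 1]].

Lemma cdual_linear (f : cdual) : linear f.
Proof. by case: f => f /= /set_mem[]. Qed.

Lemma cdual_continuous (f : cdual) : continuous f.
Proof. by case: f => f /= /set_mem[]. Qed.

HB.instance Definition _ (f : cdual) :=
  GRing.isLinear.Build C X C^o *:%R (cdual_val f) (cdual_linear f).

Lemma dual_norm_has_sup (f : cdual) :
  has_sup [set normc (f x) | x in [set x : X | `|x| <= 1]].
Proof.
split; first by exists (normc (f 0)), 0 => //=; rewrite normr0.
have /linear_boundedP/pinfty_ex_gt0[M M0 fM] :
  bounded_near (f : {linear X -> C^o}) (nbhs 0).
  by apply/linear_bounded_continuous/cdual_continuous.
exists (complex.Re M) => _ [x /= x1 <-].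
rewrite -lecR RRe_real ?gtr0_real//.
have := fM x; rewrite -[ `|f x| ]/((normc (f x))%:C) => /le_trans; apply.
by rewrite -[leRHS]mulr1 ler_wpM2l// ltW.
Qed.

Lemma dual_norm_ub (f : cdual) (x : X) :
  `|x| <= 1 -> normc (f x) <= dual_norm f.
Proof. by move=> x1; apply: (sup_upper_bound (dual_norm_has_sup f)); exists x. Qed.

Lemma dual_norm_le (f : cdual) (M : R) :
  (forall x : X, `|x| <= 1 -> normc (f x) <= M) -> dual_norm f <= M.
Proof.
move=> fM; apply: ge_sup; first by case: (dual_norm_has_sup f).
by move=> _ [x /= x1 <-]; exact: fM.
Qed.

Lemma dual_normD (f g : cdual) :
  (dual_norm (f + g))%:C <= (dual_norm f)%:C + (dual_norm g)%:C :> C.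
Proof.
rewrite -rmorphD lecR; apply: dual_norm_le => x x1.
apply: (le_trans (le_normcD (f x) (g x))).
by apply: lerD; exact: dual_norm_ub.
Qed.

Lemma dual_norm_scale_le (a : C) (f : cdual) :
  dual_norm (a *: f) <= normc a * dual_norm f.
Proof.
apply: dual_norm_le => x x1.
rewrite [X in normc X](_ : _ = a * f x)// normcM ler_wpM2l//; last first.
  exact: dual_norm_ub.
by rewrite -lecR (normr_ge0 a).
Qed.

Lemma dual_normZ (a : C) (f : cdual) :
  (dual_norm (a *: f))%:C = `|a| * (dual_norm f)%:C :> C.
Proof.
rewrite -[ `|a| ]/((normc a)%:C) -rmorphM; congr (_ %:C); apply/eqP; rewrite eq_le.
rewrite dual_norm_scale_le/=.
have [->|a0] := eqVneq a 0.
  rewrite normc0 mul0r; apply: le_trans (dual_norm_ub _ (x := 0) _).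
    by rewrite -lecR (normr_ge0 (_ : C)).
  by rewrite normr0.
rewrite -ler_pdivlMl; last by rewrite -ltcR (normr_gt0 a).
by rewrite -normcV -[in leLHS](scalerK a0 f) dual_norm_scale_le.
Qed.

Lemma dual_norm0_eq0 (f : cdual) : (dual_norm f)%:C = 0 :> C -> f = 0.
Proof.
move=> [f0]; apply/val_inj/funext => x /=.
have [->|x0] := eqVneq x 0; first by rewrite linear0.
have nx0 : `|x| != 0 by rewrite normr_eq0.
have : normc (f (`|x|^-1 *: x)) <= 0.
  by rewrite -f0; apply: dual_norm_ub; rewrite normfZV.
rewrite -lecR -[(normc _)%:C]/(`|f (`|x|^-1 *: x)|) normr_le0 linearZ/=.
by rewrite scaler_eq0 invr_eq0 (negbTE nx0)/= => /eqP.
Qed.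

HB.instance Definition _ :=
  Lmodule_isNormed.Build C cdual dual_normD dual_normZ dual_norm0_eq0.

End dual.

Section XF.
Variable R : realType.
Local Notation C := (R[i]).

Definition family_norm (F : set {fset nat}) (x : c00 C) : R :=
  sup [set \sum_(i <- A) normc (x i) | A in F].

(** (X, iota) is a completion of c00 normed by [family_norm F]; this determines
    X up to a linear isometry compatible with iota. Norms over R[i] take their
    values in R[i], hence the injection %:C. *)
Definition is_completion (F : set {fset nat}) (X : completeNormedModType C)
    (iota : {linear c00 C -> X}) : Prop :=
  (forall x : c00 C, `|iota x| = (family_norm F x)%:C) /\ dense (range iota).

Definition basis_vector (X : normedModType C) (iota : c00 C -> X) (i : nat) : X :=
  iota (c00_basis C i).

(** The i-th coordinate functional: the continuous functional biorthogonal to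
    the basis vectors. It is unique because their span is dense, and it exists
    when F contains [fset i], which gives |x i| <= family_norm F x on c00; the
    default value 0 of [xget] is then never used. *)
Definition coordinate_functional (X : normedModType C) (iota : c00 C -> X)
    (i : nat) : cdual X :=
  xget 0 [set f : cdual X | forall k, f (basis_vector iota k) = (k == i)%:R].

Definition is_isometry (V : normedModType C) (J : {linear V -> V}) : Prop :=
  (forall v, `|J v| = `|v|) /\ range J = setT.

Definition compatible_signed_permutation (F : set {fset nat})
    (V : lmodType C) (b : nat -> V) (J : V -> V) : Prop :=
  exists (omega : nat -> C) (pi : nat -> nat),
    [/\ forall i, `|omega i| = 1,
        bijective pi,
        [set (pi @` A)%fset | A in F] = F
      & forall i, J (b i) = omega i *: b (pi i)].

End XF.

(* Main.v *)
Require Import Defs.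
From HB Require Import structures.
From mathcomp Require Import all_boot all_order all_algebra finmap.
From mathcomp Require Import complex.
From mathcomp Require Import all_classical all_reals all_analysis.
From mathcomp Require Import ring.

Set Implicit Arguments.
Unset Strict Implicit.
Unset Printing Implicit Defensive.

Import Order.TTheory GRing.Theory Num.Theory.
Import Normc.

Local Open Scope classical_set_scope.
Local Open Scope ring_scope.
Local Open Scope complex_scope.

(** If [J] is an isometry of a space [V] with coordinate system [(v_k, T_k)],
    multiplying the [i]-th coordinate by a sign [a] and conjugating by [J] shows
    that [w |-> w + (a - 1) psi(w) u] is an isometry for every sign [a], where
    [u = J v_i] and [psi = T_i o J^-1].  Two coordinates [k <> m] span a plane
    that is either the l1 or the sup-norm plane; testing the isometry there gives
    [|1 + (a - 1) (p + b q)| <= 1] for all signs [a], [b], with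
    [q = psi(v_k) T_m(u)].  Such a [p + b q] is real for every [b], whence [q = 0].
    Moreover [T_m u <> 0] forces [psi(v_m) <> 0]: otherwise composing the
    reflections along [u] and along [v_m] gives a contraction translating
    [u - T_m(u) v_m] by [4 T_m(u) v_m], whose iterates are unbounded.  Hence [u] is
    supported by a single [m]. *)

(** * Complex numbers constrained by all signs *)

Section ClosedField.
Variable C : numClosedFieldType.
Implicit Types p q c a w : C.

Lemma real_of_unit_disc c :
  (forall w, `|w| = 1 -> `|1 + (w - 1) * c| <= 1) -> c \is Num.real.
Proof.
move=> c1.
have [->|c0] := eqVneq c 0; first exact: real0.
have [c1E|c1N] := eqVneq (1 - c) 0.
  by move/eqP: c1E; rewrite subr_eq0 => /eqP <-; exact: real1.
(* This sign aligns [w c] with [1 - c], giving [|1 - c| + |c| <= 1]. *)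
pose w := ((1 - c) / `|1 - c|) * (`|c| / c).
have nc : `|c| != 0 by rewrite normr_eq0.
have n1c : `|1 - c| != 0 by rewrite normr_eq0.
have w1 : `|w| = 1 by rewrite /w !normrM !normfV !normr_id !divff// mulr1.
have := c1 _ w1.
have -> : 1 + (w - 1) * c = ((1 - c) / `|1 - c|) * (`|1 - c| + `|c|).
  by rewrite /w; field; rewrite n1c c0.
rewrite normrM normrM normfV normr_id divff// mul1r ger0_norm ?addr_ge0//.
move=> le1.
(* Equality in the triangle inequality makes [c] and [1 - c] nonnegative multiples of one sign [t];
   since they add up to 1, [t] is 1. *)
have /normCDeq[t /eqP t1 [ec e1c]] : `|c + (1 - c)| = `|c| + `|1 - c|.
  apply/eqP; rewrite eq_le ler_normD/= (addrC c) subrK normr1.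
  by rewrite addrC.
have : t = 1.
  have E : (`|c| + `|1 - c|) * t = 1 by rewrite mulrDl -ec -e1c addrC subrK.
  have N : `|c| + `|1 - c| = 1.
    have := congr1 Num.norm E.
    by rewrite normrM t1 mulr1 ger0_norm ?addr_ge0// normr1.
  by move: E; rewrite N mul1r.
by move=> t1E; rewrite ec t1E mulr1 normr_real.
Qed.

(** Subtracting the values at [a = 1, -1] and at [a = i, -i] shows that [q] and [i q] are both real,
    whereas [i] is not. *)
Lemma real_circle_eq0 p q :
  (forall a, `|a| = 1 -> p + a * q \is Num.real) -> q = 0.
Proof.
move=> pq.
have R1 := pq 1 (normr1 _).
have RN1 := pq (-1) (normrN1 _).
have Ri := pq 'i%R (normCi _).
have RNi : p + - 'i%R * q \is Num.real by apply: pq; rewrite normrN normCi.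
have half (x : C) : x *+ 2 \is Num.real -> x \is Num.real.
  move=> x2; rewrite (_ : x = x *+ 2 / 2%:R); last by field.
  by rewrite rpred_div// rpred_nat.
have qR : q \is Num.real.
  apply: half; rewrite mulr2n.
  have := rpredB R1 RN1; rewrite mul1r mulN1r opprD opprK addrACA subrr add0r.
  by [].
have iqR : 'i%R * q \is Num.real.
  apply: half; rewrite mulr2n.
  by have := rpredB Ri RNi; rewrite mulNr opprD opprK addrACA subrr add0r.
have [//|q0] := eqVneq q 0.
have : 'i%R \is @Num.real C by rewrite -(mulfK q0 'i%R) rpred_div.
by rewrite CrealE conjCi eq_sym -addr_eq0 -mulr2n mulrn_eq0/= (negbTE (neq0Ci _)).
Qed.

End ClosedField.

(** * Isometries of a space with sign-invariant coordinates *)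

Section SignedCoordinates.
Variables (R : realType) (V : normedModType R[i]).
Variables (v : nat -> V) (T : nat -> {linear V -> R[i]^o}).
Local Notation C := (R[i]).

(** These properties are shared by the basis of X with its coordinate functionals and by the
    coordinate functionals with the evaluations at the basis, so that one argument serves both
    spaces. In [coord_pair] the first case is the sup-norm plane, the second the l1 plane. *)
Record sign_invariant_coordinates : Prop := SignInvariantCoordinates {
  coord_basis : forall k j, T k (v j) = (j == k)%:R;
  coord_sep : forall w, (forall k, T k w = 0) -> w = 0;
  coord_le : forall k w, `|T k w| <= `|w|;
  basis_le1 : forall k, `|v k| <= 1;
  coord_sign : forall k (a : C) w, `|a| = 1 ->
    `|w + ((a - 1) * T k w) *: v k| <= `|w|;
  coord_pair : forall k m, k != m ->
    (forall a : C, `|a| = 1 -> `|v k + a *: v m| <= 1) \/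
    (forall (a : C) w, `|a| = 1 -> `|T k w + a * T m w| <= `|w|) }.

Hypothesis vT : sign_invariant_coordinates.

Lemma basis_norm k : `|v k| = 1.
Proof.
apply/eqP; rewrite eq_le (basis_le1 vT)/=.
by have := coord_le vT k (v k); rewrite (coord_basis vT) eqxx normr1.
Qed.

Section RankOne.
Variables (u : V) (psi : {linear V -> C^o}).
Hypothesis psiu : psi u = 1.
Hypothesis psi_sign : forall (a : C) w, `|a| = 1 ->
  `|w + ((a - 1) * psi w) *: u| <= `|w|.

(** In the sup-norm case the image of [v k + b^-1 v m] is read by [T m]; in the l1 case the image of
    [v k] is read by [T k + b T m]. Up to a sign, both readings have the form
    [1 + (a - 1) (p + b q)]. *)
Lemma rank_one_off_diagonal k m : k != m -> psi (v k) * T m u = 0.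
Proof.
move=> km; case: (coord_pair vT km) => [vkm|Tkm].
  rewrite mulrC; apply: (@real_circle_eq0 _ (psi (v m) * T m u)) => b b1.
  apply: real_of_unit_disc => a a1.
  have b0 : b != 0 by rewrite -normr_eq0 b1 oner_eq0.
  pose w := v k + b^-1 *: v m.
  have w1 : `|w| <= 1 by apply: vkm; rewrite normfV b1 invr1.
  have := coord_le vT m (w + ((a - 1) * psi w) *: u).
  move=> /le_trans /(_ (psi_sign w a1)) /le_trans /(_ w1).
  rewrite -(mul1r `|T m _|) -b1 -normrM.
  congr (_ <= _); congr `|_|; rewrite !linearD !linearZ/=.
  rewrite !(coord_basis vT) eqxx (negbTE km) /GRing.scale/=.
  by rewrite b1; field.
rewrite [LHS]mulrC; apply: (@real_circle_eq0 _ (psi (v k) * T k u)) => b b1.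
apply: real_of_unit_disc => a a1.
have := Tkm b (v k + ((a - 1) * psi (v k)) *: u) b1.
move=> /le_trans /(_ (psi_sign (v k) a1)); rewrite basis_norm.
congr (_ <= _); congr `|_|; rewrite !linearD !linearZ/= !(coord_basis vT).
rewrite eqxx (negbTE km) /GRing.scale/=.
by ring.
Qed.

Lemma rank_one_diagonal m : T m u != 0 -> psi (v m) != 0.
Proof.
move=> um; apply/eqP => psim; pose f := u - T m u *: v m.
have psif : psi f = 1.
  by rewrite /f linearB linearZ/= psiu psim scaler0 subr0.
have Tf : T m f = 0.
  rewrite /f linearB linearZ/= (coord_basis vT) eqxx.
  by rewrite /GRing.scale/= mulr1 subrr.
clearbody f.
(* The composite of the reflections along [u], [v m], [u], [v m], applied to
   [f + c v_m], translates it by [4 T_m(u) v_m]. *)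
have refl_u w : `|w - (2 * psi w) *: u| <= `|w|.
  by have := psi_sign w (normrN1 _); rewrite -opprD mulNr scaleNr.
have refl_v w : `|w - (2 * T m w) *: v m| <= `|w|.
  by have := coord_sign vT m w (normrN1 _); rewrite -opprD mulNr scaleNr.
have shift c : `|f + (c + 4 * T m u) *: v m| <= `|f + c *: v m|.
  pose w1 := f - c *: v m.
  pose w2 := w1 - 2 *: u.
  pose w3 := w2 + (2 * c + 4 * T m u) *: v m.
  have psi1 : psi w1 = 1 by rewrite linearB linearZ/= psif psim scaler0 subr0.
  have psi3 : psi w3 = -1.
    rewrite linearD linearB !linearZ/= psi1 psim psiu !scaler0 addr0.
    by rewrite /GRing.scale/=; ring.
  have T1 : T m (f + c *: v m) = c.
    by rewrite linearD linearZ/= Tf (coord_basis vT) eqxx /GRing.scale/= mulr1 add0r.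
  have T2 : T m w2 = - c - 2 * T m u.
    rewrite !linearB !linearZ/= Tf (coord_basis vT) eqxx /GRing.scale/=.
    by ring.
  have E1 : w1 = (f + c *: v m) - (2 * T m (f + c *: v m)) *: v m.
    rewrite T1 -addrA -scalerBl; congr (_ + _); rewrite -scaleNr; congr (_ *: _).
    by ring.
  have E2 : w2 = w1 - (2 * psi w1) *: u by rewrite psi1 mulr1.
  have E3 : w3 = w2 - (2 * T m w2) *: v m.
    rewrite T2 -scaleNr; congr (_ + _ *: _); by ring.
  have E4 : f + (c + 4 * T m u) *: v m = w3 - (2 * psi w3) *: u.
    rewrite psi3 /w3 /w2 /w1 mulrN1 scaleNr opprK.
    rewrite addrAC subrK -addrA -scaleNr -scalerDl; congr (_ + _ *: _).
    by ring.
  rewrite E4; apply: (le_trans (refl_u _)).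
  rewrite E3; apply: (le_trans (refl_v _)).
  rewrite E2; apply: (le_trans (refl_u _)).
  by rewrite E1; apply: (le_trans (refl_v _)).
(* After [n] shifts starting from [c = 0], the [m]-th coordinate is [n * (4 * T m u)] while the norm
   is still at most that of [f]. *)
have bnd n : `|4 * T m u| *+ n <= `|f|.
  have fn : `|f + (n%:R * (4 * T m u)) *: v m| <= `|f|.
    elim: n => [|n IHn]; first by rewrite mul0r scale0r addr0.
    by apply: le_trans IHn; rewrite -natr1 mulrDl mul1r.
  apply: le_trans fn; apply: le_trans (coord_le vT m _).
  rewrite linearD linearZ/= Tf (coord_basis vT) eqxx /GRing.scale/= mulr1 add0r.
  by rewrite -normrMn -(mulr_natl (4 * _)).
have d0 : 0 < `|4 * T m u| by rewrite normr_gt0 mulf_neq0// pnatr_eq0.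
(* Both norms are real elements of [R[i]]; the Archimedean property is applied in [R] to their real
   parts. *)
move: d0 bnd; rewrite -[ `|f| ]RRe_real ?normr_real// -[ `|4 * _| ]RRe_real ?normr_real//.
set d := complex.Re _; set M := complex.Re _; rewrite ltcR => d0 bnd.
have := bnd (Num.bound `|M / d|); rewrite -rmorphMn lecR -mulr_natr.
rewrite leNgt mulrC -ltr_pdivrMr//.
move/negP; apply; apply: le_lt_trans (ler_norm _) _.
exact: archi_boundP.
Qed.

(** As [psi u = 1], some [T m u] is nonzero. Then [psi (v m)] is nonzero, and the vanishing products
    [psi (v m) * T k u] kill every other coordinate. *)
Lemma rank_one_basis : exists m, u = T m u *: v m.
Proof.
have [[m um]|no] := pselect (exists m, T m u != 0); last first.
  suff u0 : u = 0 by have := psiu; rewrite u0 linear0 => /eqP; rewrite eq_sym oner_eq0.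
  apply: (coord_sep vT) => k; apply: contrapT => /eqP uk; apply: no.
  by exists k.
exists m; apply/eqP; rewrite -subr_eq0; apply/eqP/(coord_sep vT) => k.
rewrite linearB linearZ/= (coord_basis vT) /GRing.scale/=.
have [<-|mk] := eqVneq m k; first by rewrite mulr1 subrr.
rewrite mulr0 subr0.
have /eqP := rank_one_off_diagonal mk.
by rewrite mulf_eq0 (negbTE (rank_one_diagonal um)) => /eqP.
Qed.
End RankOne.

Section SignedPermutation.
(* [P r n] says that a signed sum of [n] basis vectors of norm [r] is indexed by a
   set of [F]: [r = n] for the basis of X, [r <= 1] for the coordinate functionals. *)
Variables (F : set {fset nat}) (P : C -> nat -> Prop).
Hypothesis F_norm : forall (A : {fset nat}) (a : nat -> C), (forall i, `|a i| = 1) ->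
  F A <-> P `|\sum_(i <- A) a i *: v i| #|` A|%fset.

Lemma isometry_basis (J J' : {linear V -> V}) :
    (forall w, `|J w| = `|w|) -> cancel J J' -> cancel J' J ->
  exists (om : nat -> C) (pi : nat -> nat),
    (forall i, `|om i| = 1) /\ (forall i, J (v i) = om i *: v (pi i)).
Proof.
move=> Jn JJ' J'J.
have step i : exists p : C * nat, `|p.1| = 1 /\ J (v i) = p.1 *: v p.2.
  have [||m E] := @rank_one_basis (J (v i)) (T i \o J').
  - by rewrite /= JJ' (coord_basis vT) eqxx.
  - move=> a w a1; have := coord_sign vT i (J' w) a1.
    by rewrite -Jn linearD linearZ/= J'J => /le_trans; apply; rewrite -Jn J'J.
  exists (T m (J (v i)), m); split=> //=.
  have := congr1 Num.norm E.
  by rewrite Jn normrZ !basis_norm mulr1.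
have [p pP] := choice step.
by exists (fun i => (p i).1), (fun i => (p i).2); split=> i; have [] := pP i.
Qed.

(** Linear independence makes the index maps of [J] and of its inverse mutually inverse. Since [J]
    carries a signed sum over [A] to one over [pi(A)] with the same norm and number of terms,
    [F_norm] transfers membership in [F]. *)
Lemma isometry_signed_permutation (J : {linear V -> V}) :
  is_isometry J -> compatible_signed_permutation F v J.
Proof.
move=> [Jn /seteqP[_ Jsurj]].
have [J0 J0K] : exists J0 : V -> V, cancel J0 J.
  suff /choice[J0 J0K] : forall w, exists w', J w' = w by exists J0.
  by move=> w; have [w' _ <-] := Jsurj w I; exists w'.
have KJ0 : cancel J J0.
  move=> w; apply/eqP; rewrite -subr_eq0 -normr_eq0 -Jn linearB J0K subrr normr0.
  by [].
pose J' : {linear V -> V} := HB.pack J0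
  (GRing.isLinear.Build _ _ _ _ J0 (GRing.can2_linear KJ0 J0K)).
have KJ : cancel J J' by exact: KJ0.
have J'K : cancel J' J by exact: J0K.
clearbody J'.
have J'n w : `|J' w| = `|w| by rewrite -[in RHS](J'K w) Jn.
have [om [pi [om1 JE]]] := isometry_basis Jn (J' := J') KJ J'K.
have [om' [pi' [om'1 J'E]]] := isometry_basis J'n (J' := J) J'K KJ.
have basis_inj (a : C) i j : v i = a *: v j -> i = j.
  move=> E; apply: contrapT => /eqP ij.
  have := congr1 (T i) E; rewrite linearZ/= !(coord_basis vT) eqxx eq_sym (negbTE ij).
  by rewrite /GRing.scale/= mulr0 => /eqP; rewrite oner_eq0.
have piK : cancel pi pi'.
  move=> i; apply/esym; apply: (basis_inj (om i * om' (pi i))).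
  by rewrite -scalerA -J'E -linearZ -JE KJ.
have pi'K : cancel pi' pi.
  move=> i; apply/esym; apply: (basis_inj (om' i * om (pi' i))).
  by rewrite -scalerA -JE -linearZ -J'E J'K.
have piF A : F (pi @` A)%fset <-> F A.
  (* These signs make the sum over [pi(A)] exactly the image under [J] of the unsigned sum over
     [A]. *)
  rewrite (F_norm (pi @` A)%fset (a := om \o pi')); last by move=> i; exact: om1.
  rewrite (F_norm A (a := fun=> 1)); last by move=> i; rewrite normr1.
  rewrite card_imfset/=; last exact: can_inj piK.
  rewrite -[X in _ <-> P X _]Jn linear_sum/=.
  rewrite big_imfset/=; last by move=> i j _ _; exact: (can_inj piK).
  under [in X in _ <-> X]eq_bigr do rewrite scale1r JE.
  by under eq_bigr do rewrite piK.
exists om, pi; split=> //; first by exists pi'.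
apply/seteqP; split=> [_ [A FA <-]|A FA]; first exact/piF.
have E : A = (pi @` (pi' @` A))%fset.
  apply/fsetP => i; rewrite -imfset_comp/=.
  apply/idP/imfsetP => [iA|[j /= jA ->]]; last by rewrite pi'K.
  by exists i; rewrite //= pi'K.
exists (pi' @` A)%fset => //; apply/piF; by rewrite -E.
Qed.

End SignedPermutation.
End SignedCoordinates.

(** * The family norm on finitely supported sequences *)

Lemma ler_sum_fsubset (R : realDomainType) (f : nat -> R) (A B : {fset nat}) :
  (forall i, 0 <= f i) -> (A `<=` B)%fset ->
  \sum_(i <- A) f i <= \sum_(i <- B) f i.
Proof.
move=> f0 AB; have E : [fset x in B | x \in A]%fset = A.
  apply/fsetP => i; rewrite !inE/= andbC; case: (boolP (i \in A)) => //= iA.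
  by rewrite (fsubsetP AB).
by rewrite (big_fsetID _ (mem A) B)/= E lerDl sumr_ge0.
Qed.

Section Completion.
Variables (R : realType) (F : set {fset nat}).
Local Notation C := (R[i]).
Hypothesis F_comb : combinatorial_family F.
Implicit Types (c d : c00 C) (A B : {fset nat}) (a : nat -> C).

Lemma normcR (z : C) : `|z| = (normc z)%:C.
Proof. by []. Qed.

Lemma family_fset0 : F fset0.
Proof. by apply: F_comb.2 (fsub0set _) (F_comb.1 0%N). Qed.

(** Enlarging [A] by the support of [c] can only increase the sum, and the enlarged sum equals the
    one over the support. *)
Lemma family_norm_has_sup c : has_sup [set \sum_(i <- A) normc (c i) | A in F].
Proof.
split; first by exists (\sum_(i <- fset0) normc (c i)), fset0 => //; exact: family_fset0.
have cfin : finite_set [set i | c i != 0] by case: c => c /= /set_mem.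
pose S := fset_set [set i | c i != 0].
exists (\sum_(i <- S) normc (c i)) => _ [A _ <-].
have nc0 i : 0 <= normc (c i) by rewrite -lecR; exact: (normr_ge0 (c i : C)).
apply: (@le_trans _ _ (\sum_(i <- (A `|` S)%fset) normc (c i))).
  by apply: ler_sum_fsubset => //; exact: fsubsetUl.
rewrite le_eqVlt; apply/orP; left; apply/eqP/esym/big_fset_incl.
  exact: fsubsetUr.
move=> i _; rewrite in_fset_set// => /negP; rewrite inE/= => /negP.
by rewrite negbK => /eqP ->; exact: normc0.
Qed.

Lemma family_norm_ge c A : F A -> \sum_(i <- A) normc (c i) <= family_norm F c.
Proof.
by move=> FA; apply: (sup_upper_bound (family_norm_has_sup c)); exists A.
Qed.

Lemma family_norm_le c (M : R) :
  (forall A, F A -> \sum_(i <- A) normc (c i) <= M) -> family_norm F c <= M.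
Proof.
move=> cM; apply: ge_sup; first by case: (family_norm_has_sup c).
by move=> _ [A FA <-]; exact: cM.
Qed.

Lemma c00D c d k : (c + d) k = c k + d k.
Proof. by []. Qed.

Lemma c00Z (z : C) c k : (z *: c) k = z * c k.
Proof. by []. Qed.

Lemma c00B c d k : (c - d) k = c k - d k.
Proof. by []. Qed.

Lemma c00_sum (I : Type) (r : seq I) (c : I -> c00 C) k :
  (\sum_(i <- r) c i) k = \sum_(i <- r) c i k.
Proof.
elim: r => [|i r IH]; first by rewrite !big_nil.
by rewrite !big_cons c00D IH.
Qed.

Lemma c00_basisE i k : c00_basis C i k = (k == i)%:R.
Proof. by []. Qed.

Lemma c00_expand c : exists n, c = \sum_(i < n) c i *: c00_basis C i.
Proof.
have cfin : finite_set [set i | c i != 0] by case: c => c /= /set_mem.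
have [n cn] : exists n, forall i, (n <= i)%N -> c i = 0.
  exists (\max_(i <- fset_set [set i | c i != 0]) i).+1 => i.
  apply: contraTeq => ci; rewrite -ltnNge ltnS.
  apply: (@leq_bigmax_seq _ _ xpredT id) => //.
  by rewrite in_fset_set// inE.
exists n; apply/val_inj/funext => k /=; rewrite c00_sum.
under eq_bigr do rewrite c00Z c00_basisE.
have [kn|nk] := ltnP k n; last first.
  rewrite cn// big1// => i _; rewrite gtn_eqF ?mulr0//.
  exact: leq_trans (ltn_ord i) nk.
rewrite (bigD1 (Ordinal kn))//= eqxx mulr1 big1 ?addr0// => i ik.
case: eqP => [ki|]; last by rewrite mulr0.
by case/eqP: ik; apply/val_inj.
Qed.

Definition signed_indicator A a : c00 C := \sum_(i <- A) a i *: c00_basis C i.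

Lemma signed_indicatorE A a k : signed_indicator A a k = if k \in A then a k else 0.
Proof.
rewrite c00_sum; under eq_bigr do rewrite c00Z c00_basisE.
case: ifPn => kA; last first.
  rewrite big_seq big1// => i iA; case: eqP => [ki|]; last by rewrite mulr0.
  by rewrite ki iA in kA.
rewrite (big_fsetD1 k)//= eqxx mulr1 big_seq big1 ?addr0// => i.
by rewrite !inE eq_sym => /andP[/negbTE -> _]; rewrite mulr0.
Qed.

(** * Norms of signed sums in the completion *)

Section Embedding.
Variables (X : completeNormedModType C) (iota : {linear c00 C -> X}).
Hypothesis X_compl : is_completion F iota.
Local Notation e := (basis_vector iota).

Lemma iota_norm c : `|iota c| = (family_norm F c)%:C.
Proof. exact: X_compl.1. Qed.

(** This is the 1-unconditionality of the basis. *)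
Lemma iota_mono c d : (forall k, `|c k| <= `|d k|) -> `|iota c| <= `|iota d|.
Proof.
move=> cd; rewrite !iota_norm lecR; apply: family_norm_le => A FA.
apply: le_trans (family_norm_ge d FA); apply: ler_sum => i _.
by have := cd i; rewrite !normcR lecR.
Qed.

Lemma iota_ge A a c : F A -> (forall i, `|a i| = 1) ->
  `|\sum_(i <- A) a i * c i| <= `|iota c|.
Proof.
move=> FA a1; apply: le_trans (ler_norm_sum _ _ _) _.
under eq_bigr do rewrite normrM a1 mul1r normcR.
by rewrite -rmorph_sum iota_norm lecR family_norm_ge.
Qed.

Lemma iota_ge_coord c k : `|c k| <= `|iota c|.
Proof.
have := @iota_ge [fset k]%fset (fun=> 1) c (F_comb.1 k).
by rewrite big_seq_fset1 mul1r; apply => i; rewrite normr1.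
Qed.

Lemma iota_signed_indicator A a :
  iota (signed_indicator A a) = \sum_(i <- A) a i *: e i.
Proof. by rewrite linear_sum; apply: eq_bigr => i _; rewrite linearZ. Qed.

Lemma signed_sum_norm_le A a n : (forall i, `|a i| = 1) ->
    (forall B, F B -> #|` A `&` B|%fset <= n)%N ->
  `|\sum_(i <- A) a i *: e i| <= n%:R.
Proof.
move=> a1 ABn; rewrite -iota_signed_indicator iota_norm.
rewrite -(rmorph_nat (real_complex R)) lecR; apply: family_norm_le => B FB.
apply: le_trans (_ : #|` A `&` B|%fset%:R <= _); last by rewrite ler_nat ABn.
rewrite card_fset_sum1 natr_sum.
rewrite [leRHS](_ : _ = \sum_(i <- B) (i \in A)%:R).
  apply: ler_sum => i _; rewrite signed_indicatorE.
  case: ifPn => _; last by rewrite normc0.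
  by rewrite -lecR -normcR a1.
rewrite (big_fsetID _ (mem A) B)/= [X in _ + X]big1_seq ?addr0.
  rewrite (_ : [fset x in B | x \in A]%fset = (A `&` B)%fset).
    by apply: eq_big_seq => i; rewrite inE => /andP[->].
  by apply/fsetP => i; rewrite !inE andbC.
by move=> i /=; rewrite !inE => /andP[_ /negbTE ->].
Qed.

Lemma signed_sum_norm_family A a : (forall i, `|a i| = 1) -> F A ->
  `|\sum_(i <- A) a i *: e i| = #|` A|%fset%:R.
Proof.
move=> a1 FA; apply/eqP; rewrite eq_le signed_sum_norm_le//=; last first.
  by move=> B _; apply/fsubset_leq_card/fsubsetIl.
rewrite -iota_signed_indicator.
have aV1 i : `|(a i)^-1| = 1 by rewrite normfV a1 invr1.
have := iota_ge (signed_indicator A a) FA aV1.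
rewrite big_seq (eq_bigr (fun=> 1)) => [|i iA]; last first.
  by rewrite signed_indicatorE iA mulVf// -normr_eq0 a1 oner_eq0.
by rewrite -big_seq big_const_seq count_predT -Monoid.iteropE ger0_norm.
Qed.

(** By heredity no member of [F] contains [A], so each one misses at least one point of [A]. *)
Lemma signed_sum_norm_nonfamily A a : (forall i, `|a i| = 1) -> ~ F A ->
  `|\sum_(i <- A) a i *: e i| <= #|` A|%fset%:R - 1.
Proof.
move=> a1 FA.
(* Nonemptiness of [A] keeps the natural-number subtraction below from truncating. *)
have A0 : (0 < #|` A|%fset)%N.
  by rewrite cardfs_gt0; apply/eqP => A0; apply: FA; rewrite A0; exact: family_fset0.
rewrite -[X in _ - X]/(1%:R) -natrB//; apply: signed_sum_norm_le => // B FB.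
rewrite subn1 -ltnS prednK// ltn_neqAle fsubset_leq_card ?fsubsetIl// andbT.
apply/eqP => AB; apply: FA; apply: (F_comb.2 _ B) => //.
apply/fsetIidPl/eqP; rewrite eqEfcard fsubsetIl/= AB//.
Qed.

(** * Extension of the coordinates to the completion *)

Lemma iota_approx (x : X) (eps : C) : 0 < eps -> exists c, `|x - iota c| < eps.
Proof.
move=> eps0; have [_ dns] := X_compl.
have [||y [xy [c _ cE]]] := dns (ball x eps).
- by exists x; exact: ballxx.
- exact: ball_open.
by exists c; move: xy; rewrite -cE -ball_normE.
Qed.

Lemma norm_le_eps_eq0 (V : normedModType C) (w : V) (M : C) :
  0 <= M -> (forall eps, 0 < eps -> `|w| <= M * eps) -> w = 0.
Proof.
move=> M0 wM; apply/eqP; rewrite -normr_eq0; apply: contraT => w0.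
have w_gt0 : 0 < `|w| by rewrite lt_neqAle eq_sym w0 normr_ge0.
have M1 : 0 < M + 1 by rewrite ltr_wpDl.
have := wM (`|w| / (M + 1)) (divr_gt0 w_gt0 M1).
rewrite mulrCA ler_pMr// ler_pdivlMr// mul1r.
by rewrite gerDl ler10.
Qed.

(* The supremum of [g (c k) - |iota c - x|] over [c] plays the role of the limit,
   since [R[i]] carries no completeness instance. *)
Lemma real_coordinate_ext k (g : C -> R) (x : X) :
    (forall z w, g z - g w <= complex.Re `|z - w|) ->
  exists s : R, forall c, `|g (c k) - s| <= complex.Re `|iota c - x|.
Proof.
move=> g_lip; pose r c := complex.Re `|iota c - x|.
(* The intervals of radius [r c] around [g (c k)] meet pairwise; the supremum of their left ends
   lies in all of them. *)
have lt_r c d : g (c k) - r c <= g (d k) + r d.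
  rewrite lerBlDr -addrA -lerBlDl; apply: le_trans (g_lip _ _) _.
  rewrite /r -raddfD/=.
  have := iota_ge_coord (c - d) k; rewrite c00B => /le_trans le1.
  have : `|c k - d k| <= `|iota d - x| + `|iota c - x|.
    by apply: le1; rewrite linearB [leRHS]addrC (distrC (iota d)) ler_distD.
  by rewrite lecE => /andP[].
pose S := [set g (c k) - r c | c in [set: c00 C]].
have S_sup : has_sup S.
  split; first by exists (g ((0 : c00 C) k) - r 0), 0.
  by exists (g ((0 : c00 C) k) + r 0) => _ [c _ <-]; exact: lt_r.
exists (sup S) => c; rewrite ler_norml; apply/andP; split.
  rewrite lerNl opprB lerBlDl addrC; apply: ge_sup; first by case: S_sup.
  by move=> _ [d _ <-]; rewrite addrC; exact: lt_r.
by rewrite lerBlDr addrC -lerBlDr; apply: sup_upper_bound => //; exists c.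
Qed.

Lemma norm_real_complex (s : R) : `|s%:C| = `|s|%:C.
Proof. by rewrite normc_def/= expr0n addr0 sqrtr_sqr. Qed.

Lemma norm_i : `|'i : C| = 1.
Proof. by rewrite normc_def/= expr0n expr1n add0r sqrtr1. Qed.

(** The factor 2 comes from extending real and imaginary parts separately; [coordinate_le] later
    gives the sharp bound. *)
Lemma coordinate_ext k (x : X) : exists z : C, forall c, `|c k - z| <= 2 * `|iota c - x|.
Proof.
have Re_le (z : C) : `|complex.Re z| <= complex.Re `|z|.
  by have := normc_ge_Re z; rewrite -[ `|z|]RRe_real ?normr_real// lecR.
have Im_le (z : C) : `|complex.Im z| <= complex.Re `|z|.
  have := Re_le (- 'i * z); rewrite normrM normrN norm_i mul1r.
  by case: z => a b /=; rewrite oppr0 mul0r mulN1r sub0r opprK.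
have [s sP] : exists s : R, forall c, `|complex.Re (c k) - s| <= complex.Re `|iota c - x|.
  apply: real_coordinate_ext => z w; rewrite -raddfB.
  exact: le_trans (ler_norm _) (Re_le _).
have [t tP] : exists s : R, forall c, `|complex.Im (c k) - s| <= complex.Re `|iota c - x|.
  apply: real_coordinate_ext => z w; rewrite -raddfB.
  exact: le_trans (ler_norm _) (Im_le _).
exists (s +i* t) => c.
rewrite (complexE (c k - _)); apply: le_trans (ler_normD _ _) _.
rewrite mulr_natl mulr2n normrM norm_i mul1r !norm_real_complex.
rewrite -[ `|iota c - x|]RRe_real ?normr_real//.
by apply: lerD; rewrite lecR raddfB; [exact: sP|exact: tP].
Qed.
Lemma coordinate_exists k : exists f : cdual X, forall c, f (iota c) = c k.
Proof.
have [z zP] := choice (coordinate_ext k).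
have z_iota c : z (iota c) = c k.
  by have := zP (iota c) c; rewrite subrr normr0 mulr0 normr_le0 subr_eq0 => /eqP.
have z_lin : linear (z : X -> C^o).
  move=> a x y; apply/eqP; rewrite -subr_eq0; apply/eqP.
  (* The defect of linearity splits into three approximation errors, at [x], [y] and [a x + y],
     whose bounds add up to [4 (|a| + 1) eps]. *)
  apply: (@norm_le_eps_eq0 C^o _ (4 * (`|a| + 1))) => [|eps eps0].
    by rewrite mulr_ge0// addr_ge0.
  have [c cx] := iota_approx x eps0; have [d dy] := iota_approx y eps0.
  have cz := zP x c; have dz := zP y d.
  have cdz := zP (a *: x + y) (a *: c + d).
  rewrite distrC in cx; rewrite distrC in dy.
  have E1 : z (a *: x + y) - (a * z x + z y) =
     a * (c k - z x) + (d k - z y) - ((a *: c + d) k - z (a *: x + y)).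
    by rewrite c00D c00Z; ring.
  have E2 : iota (a *: c + d) - (a *: x + y) = a *: (iota c - x) + (iota d - y).
    by rewrite linearD linearZ/= scalerBr opprD addrACA.
  rewrite [X in `|X|]E1.
  apply: (@le_trans _ _ (`|a| * (2 * eps) + 2 * eps + 2 * (`|a| * eps + eps))); last first.
    by rewrite le_eqVlt; apply/orP; left; apply/eqP; ring.
  apply: le_trans (ler_normB _ _) _; apply: lerD.
    apply: le_trans (ler_normD _ _) _; apply: lerD.
      rewrite normrM; apply: ler_wpM2l => //; apply: le_trans cz _.
      by apply: ler_wpM2l => //; exact: ltW.
    by apply: le_trans dz _; apply: ler_wpM2l => //; exact: ltW.
  apply: le_trans cdz _; apply: ler_wpM2l => //; rewrite E2.
  apply: le_trans (ler_normD _ _) _; apply: lerD; last exact: ltW.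
  by rewrite normrZ; apply: ler_wpM2l => //; exact: ltW.
pose h : {linear X -> C^o} := HB.pack (z : X -> C^o)
  (GRing.isLinear.Build _ _ _ _ _ z_lin).
(* Approximating by the zero sequence bounds the functional. *)
have h_le x : `|h x| <= 2 * `|x|.
  by have := zP x 0; rewrite linear0 sub0r normrN sub0r normrN.
have z_cont : continuous (z : X -> C^o).
  apply/(linear_bounded_continuous h)/linear_boundedP.
  exists 2; split=> [|r r2 x]; first exact: realn.
  by apply: le_trans (h_le x) _; apply: ler_wpM2r => //; exact: ltW.
have zc : (z : X -> C^o) \in @continuous_functional _ X by apply/mem_set; split.
by exists (CDual zc).
Qed.

Lemma cdualD (f g : cdual X) x : (f + g) x = f x + g x.
Proof. by []. Qed.

Lemma cdualZ (z : C) (f : cdual X) x : (z *: f) x = z * f x.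
Proof. by []. Qed.

Lemma cdual_sum (I : Type) (r : seq I) (f : I -> cdual X) x :
  (\sum_(i <- r) f i) x = \sum_(i <- r) f i x.
Proof.
elim: r => [|i r IH]; first by rewrite !big_nil.
by rewrite !big_cons cdualD IH.
Qed.

Lemma cdual_le (f : cdual X) x : `|f x| <= `|f| * `|x|.
Proof.
have [->|x0] := eqVneq x 0; first by rewrite linear0 !normr0 mulr0.
have nx : 0 < `|x| by rewrite normr_gt0.
rewrite -ler_pdivrMr//.
have := dual_norm_ub f (x := `|x|^-1 *: x).
rewrite -lecR -!normcR linearZ/= normrM normfV normr_id mulrC; apply.
by rewrite normfZV.
Qed.

Lemma cdual_norm_le (f : cdual X) (M : C) :
  0 <= M -> (forall x, `|f x| <= M * `|x|) -> `|f| <= M.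
Proof.
move=> M0 fM; rewrite -(RRe_real (ger0_real M0)) lecR; apply: dual_norm_le => x x1.
rewrite -lecR -normcR RRe_real ?ger0_real//; apply: le_trans (fM x) _.
by rewrite ler_piMr.
Qed.

(** * Contractive estimates for the coordinate functionals *)

Local Notation es := (coordinate_functional iota).

Lemma coordinateE k c : es k (iota c) = c k.
Proof.
have [f fP] := coordinate_exists k.
have esP : forall j, es k (e j) = (j == k)%:R.
  (* Existence of a biorthogonal functional rules out the default value of [xget]. *)
  apply: (xgetPex 0 (P := [set f : cdual X | forall j, f (e j) = (j == k)%:R])).
  by exists f => j; rewrite fP c00_basisE eq_sym.
have [n cE] := c00_expand c; rewrite cE !linear_sum c00_sum.
apply: eq_bigr => i _; rewrite c00Z c00_basisE linearZ/= linearZ/=.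
by rewrite [X in _ *: X](esP i) eq_sym.
Qed.

Lemma coordinate_basis k j : es k (e j) = (j == k)%:R.
Proof. by rewrite coordinateE c00_basisE eq_sym. Qed.

(** An excess of [|h x|] over [|x|] is at most [(M + 1) |x - iota c|], hence arbitrarily small. Any
    crude bound [M] thus improves to 1. Asking only for compatibility with differences lets [h] be a
    plain function. *)
Lemma dense_contraction (W : normedModType C) (h : X -> W) (M : C) : 0 <= M ->
    (forall x y, h (x - y) = h x - h y) -> (forall x, `|h x| <= M * `|x|) ->
    (forall c, `|h (iota c)| <= `|iota c|) ->
  forall x, `|h x| <= `|x|.
Proof.
move=> M0 hB hM h_iota x; rewrite real_leNgt ?normr_real//; apply/negP => lt_x.
pose eps := (`|h x| - `|x|) / (M + 1).
have M1 : 0 < M + 1 by rewrite ltr_wpDl.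
have eps0 : 0 < eps by rewrite divr_gt0// subr_gt0.
have [c cx] := iota_approx x eps0.
suff : `|h x| < `|h x| by rewrite ltxx.
have hxc : `|h x - h (iota c)| <= M * `|x - iota c| by rewrite -hB.
have cx' : `|iota c| <= `|x - iota c| + `|x|.
  by rewrite -lerBlDr (distrC x) lerB_dist.
rewrite -[X in `|X| < _](subrK (h (iota c))).
apply: le_lt_trans (ler_normD _ _) _.
apply: le_lt_trans (lerD hxc (le_trans (h_iota c) cx')) _.
rewrite addrA -[X in _ + X + _]mul1r -mulrDl -ltrBrDr.
by rewrite mulrC -ltr_pdivlMr.
Qed.

Lemma signed_coordinate_sum_le A a x : F A -> (forall i, `|a i| = 1) ->
  `|\sum_(i <- A) a i * es i x| <= `|x|.
Proof.
move=> FA a1; pose f : cdual X := \sum_(i <- A) a i *: es i.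
have fE y : f y = \sum_(i <- A) a i * es i y by rewrite cdual_sum.
rewrite -fE; apply: (@dense_contraction C^o f `|f|) => [//|y w|y|c].
- exact: linearB.
- exact: cdual_le.
- rewrite fE; under eq_bigr do rewrite coordinateE.
  exact: iota_ge.
Qed.

Lemma coordinate_le k x : `|es k x| <= `|x|.
Proof.
have := @signed_coordinate_sum_le [fset k]%fset (fun=> 1) x (F_comb.1 k).
by rewrite big_seq_fset1 mul1r; apply => i; rewrite normr1.
Qed.

Lemma coordinate_pair_le k m (z : C) x : F [fset k; m]%fset -> k != m -> `|z| = 1 ->
  `|es k x + z * es m x| <= `|x|.
Proof.
move=> Fkm km z1.
have := @signed_coordinate_sum_le _ (fun i => if i == m then z else 1) x Fkm.
rewrite big_fsetU1 ?inE//= big_seq_fset1 eqxx (negbTE km) mul1r; apply => i.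
by case: ifP => // _; rewrite normr1.
Qed.

Lemma basis_vector_le1 k : `|e k| <= 1.
Proof.
have := @signed_sum_norm_family [fset k]%fset (fun=> 1) _ (F_comb.1 k).
by rewrite big_seq_fset1 scale1r cardfs1 => -> // i; rewrite normr1.
Qed.

Lemma basis_pair_le1 k m (z : C) : ~ F [fset k; m]%fset -> k != m -> `|z| = 1 ->
  `|e k + z *: e m| <= 1.
Proof.
move=> Fkm km z1.
have := @signed_sum_norm_nonfamily _ (fun i => if i == m then z else 1) _ Fkm.
rewrite big_fsetU1 ?inE//= big_seq_fset1 eqxx (negbTE km) scale1r cardfs2 km/=.
rewrite [2%:R - 1](_ : _ = 1); last by ring.
by apply => i; case: ifP => // _; rewrite normr1.
Qed.

(** On [c00] the map multiplies the [k]-th entry by a sign and so preserves all moduli; density does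
    the rest. *)
Lemma coordinate_sign k (z : C) x : `|z| = 1 ->
  `|x + ((z - 1) * es k x) *: e k| <= `|x|.
Proof.
move=> z1; apply: (@dense_contraction X (fun x => x + ((z - 1) * es k x) *: e k)
    (1 + `|z - 1|)) => [|y w|y|c].
- by rewrite addr_ge0.
- by rewrite linearB/= mulrBr scalerBl opprD addrACA.
- apply: le_trans (ler_normD _ _) _; rewrite [leRHS]mulrDl mul1r lerD2l normrZ normrM.
  rewrite -mulrA ler_wpM2l//; apply: le_trans (coordinate_le k y).
  by rewrite ler_piMr// basis_vector_le1.
rewrite coordinateE -linearZ -linearD; apply: iota_mono => j.
rewrite c00D c00Z c00_basisE; have [->|_] := eqVneq j k.
  rewrite mulr1 mulrBl mul1r addrC subrK normrM z1 mul1r.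
  exact: lexx.
by rewrite mulr0 addr0.
Qed.

(** The truncation [h] to the first [n] coordinates is a contraction that kills [x] and fixes
    [iota c]. Hence [|iota c| <= |x - iota c|], and [|x|] is at most [2 eps]. *)
Lemma coordinate_sep x : (forall k, es k x = 0) -> x = 0.
Proof.
move=> x0; apply: (@norm_le_eps_eq0 X _ 2) => // eps eps0.
have [c cx] := iota_approx x eps0.
have [n cE] := c00_expand c.
pose h y := \sum_(k < n) es k y *: e k.
have hB y w : h (y - w) = h y - h w.
  by rewrite /h -sumrB; apply: eq_bigr => i _; rewrite linearB scalerBl.
have h_le : forall y, `|h y| <= `|y|.
  (* The crude bound [n] counts the terms of [h], each of norm at most [|y|]. *)
  apply: (@dense_contraction X h n%:R) => // [y|d].
    apply: le_trans (ler_norm_sum _ _ _) _.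
    rewrite -[X in X%:R]card_ord mulr_natl -sumr_const; apply: ler_sum => i _.
    rewrite normrZ; apply: le_trans (coordinate_le i y).
    by rewrite ler_piMr// basis_vector_le1.
  have -> : h (iota d) = iota (\sum_(k < n) d k *: c00_basis C k).
    by rewrite linear_sum; apply: eq_bigr => i _; rewrite coordinateE linearZ.
  apply: iota_mono => k; rewrite c00_sum.
  under eq_bigr do rewrite c00Z c00_basisE.
  have [kn|nk] := ltnP k n; last first.
    rewrite big1 ?normr0// => i _; rewrite gtn_eqF ?mulr0//.
    exact: leq_trans (ltn_ord i) nk.
  rewrite (bigD1 (Ordinal kn))//= eqxx mulr1 big1 ?addr0// => i ik.
  case: eqP => [ki|]; last by rewrite mulr0.
  by case/eqP: ik; apply/val_inj.
have hc : h (iota c) = iota c.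
  rewrite [in RHS]cE linear_sum; apply: eq_bigr => i _.
  by rewrite coordinateE linearZ.
have hx : h x = 0 by rewrite /h big1// => i _; rewrite x0 scale0r.
have := h_le (x - iota c); rewrite hB hx hc sub0r normrN => c_le.
rewrite -[x in `|x|](subrK (iota c)); apply: le_trans (ler_normD _ _) _.
rewrite mulr_natl mulr2n; apply: lerD; first exact: ltW.
exact: le_trans c_le (ltW cx).
Qed.

Lemma basis_sep (f : cdual X) : (forall k, f (e k) = 0) -> f = 0.
Proof.
move=> fe; apply/val_inj/funext => x /=.
apply: (@norm_le_eps_eq0 C^o _ `|f|) => // eps eps0.
have [c cx] := iota_approx x eps0.
have fc : f (iota c) = 0.
  have [n ->] := c00_expand c; rewrite !linear_sum big1// => i _.
  by rewrite !linearZ/= -[iota _]/(e i) fe scaler0.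
have : `|f (x - iota c)| <= `|f| * eps.
  by apply: le_trans (cdual_le _ _) _; rewrite ler_wpM2l// ltW.
by rewrite linearB/= fc subr0.
Qed.

Lemma basis_coordinates : sign_invariant_coordinates e es.
Proof.
split.
- exact: coordinate_basis.
- exact: coordinate_sep.
- by move=> k w; exact: coordinate_le.
- exact: basis_vector_le1.
- by move=> k z w; exact: coordinate_sign.
- move=> k m km; have [Fkm|Fkm] := pselect (F [fset k; m]%fset); [right|left].
    by move=> z w z1; exact: coordinate_pair_le.
  by move=> z z1; exact: basis_pair_le1.
Qed.

Lemma family_basis_norm A a : (forall i, `|a i| = 1) ->
  F A <-> `|\sum_(i <- A) a i *: e i| = #|` A|%fset%:R.
Proof.
move=> a1; split=> [|En]; first exact: signed_sum_norm_family.
apply: contrapT => /(signed_sum_norm_nonfamily a1); rewrite En.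
by rewrite lerDl oppr_ge0 ler10.
Qed.

(** * Coordinates on the dual *)

Definition evaluation (x : X) (f : cdual X) : C^o := f x.

Lemma evaluation_linear x : linear (evaluation x).
Proof. by []. Qed.

HB.instance Definition _ x :=
  GRing.isLinear.Build C (cdual X) C^o *:%R (evaluation x) (evaluation_linear x).

Local Notation ev := (fun k => (evaluation (e k) : {linear cdual X -> C^o})).

(** Each estimate is the transpose of one on X, so the two cases of [coord_pair] trade places: a
    pair in [F] now spans a sup-norm plane. *)
Lemma dual_basis_coordinates : sign_invariant_coordinates es ev.
Proof.
split.
- by move=> k j /=; rewrite [LHS]coordinate_basis eq_sym.
- exact: basis_sep.
- move=> k f; apply: le_trans (cdual_le f (e k)) _.
  by rewrite ler_piMr// basis_vector_le1.
- by move=> k; apply: cdual_norm_le => // x; rewrite mul1r coordinate_le.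
- move=> k z f z1; apply: cdual_norm_le => // x.
  rewrite cdualD cdualZ.
  (* The sign change on the dual is the adjoint of the sign change on X. *)
  have -> : f x + (z - 1) * ev k f * es k x = f (x + ((z - 1) * es k x) *: e k).
    by rewrite linearD linearZ/= /GRing.scale/= /evaluation mulrAC.
  by apply: le_trans (cdual_le _ _) _; rewrite ler_wpM2l// coordinate_sign.
- move=> k m km; have [Fkm|Fkm] := pselect (F [fset k; m]%fset); [left|right].
    move=> z z1; apply: cdual_norm_le => // x.
    by rewrite mul1r cdualD cdualZ coordinate_pair_le.
  move=> z f z1; rewrite /= /evaluation.
  have -> : f (e k) + z * f (e m) = f (e k + z *: e m) by rewrite linearD linearZ.
  by apply: le_trans (cdual_le _ _) _; rewrite ler_piMr// basis_pair_le1.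
Qed.

Lemma family_dual_norm A a : (forall i, `|a i| = 1) ->
  F A <-> `|\sum_(i <- A) a i *: es i| <= 1.
Proof.
move=> a1; split=> [FA|le1].
  apply: cdual_norm_le => // x; rewrite mul1r cdual_sum.
  exact: signed_coordinate_sum_le.
apply: contrapT => FA.
have aV1 i : `|(a i)^-1| = 1 by rewrite normfV a1 invr1.
(* With inverse signs on [A], the functional takes the value [#|A|] at a vector of norm at most
   [#|A| - 1], so its norm exceeds 1. *)
pose c := signed_indicator A (fun i => (a i)^-1).
have := le_trans (cdual_le _ (iota c)) (ler_wpM2r (normr_ge0 _) le1).
have -> : (\sum_(i <- A) a i *: es i : cdual X) (iota c) = #|` A|%fset%:R.
  rewrite cdual_sum big_seq (eq_bigr (fun=> 1)) => [|i iA]; last first.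
    rewrite cdualZ coordinateE signed_indicatorE iA mulfV//.
    by rewrite -normr_eq0 a1 oner_eq0.
  by rewrite -big_seq big_const_seq count_predT -Monoid.iteropE.
rewrite mul1r normr_nat iota_signed_indicator => le2.
have := le_trans le2 (signed_sum_norm_nonfamily aV1 FA).
by rewrite lerDl oppr_ge0 ler10.
Qed.

End Embedding.
End Completion.

Theorem proposition1p3 (R : realType) (F : set {fset nat})
    (F_comb : combinatorial_family F)
    (X : completeNormedModType R[i]) (iota : {linear c00 R[i] -> X})
    (X_compl : is_completion F iota) :
  (forall J : {linear X -> X},
     is_isometry J ->
     compatible_signed_permutation F (basis_vector iota) J) /\
  (compact_family F ->
   forall J : {linear cdual X -> cdual X},
     is_isometry J ->
     compatible_signed_permutation F (coordinate_functional iota) J).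
Proof.
split=> [J|_ J].
  apply: (isometry_signed_permutation (basis_coordinates F_comb X_compl)
    (P := fun r n => r = n%:R)) => A a.
  exact: family_basis_norm.
apply: (isometry_signed_permutation (dual_basis_coordinates F_comb X_compl)
  (P := fun r _ => r <= 1)) => A a.
exact: family_dual_norm.
Qed.
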